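(* Let $X_1,X_2,\dots\subset\mathbb S^d$ be the finite point sets and $\varphi_{\rho_1},\varphi_{\rho_2},\dots$ the scaled zonal kernels of a multilevel quasi-interpolation scheme, with $$Q_{X_j,\rho_j}f(x)=\frac1{|X_j|}\sum_{x_k\in X_j}f(x_k)\,\varphi_{\rho_j}(x\cdot x_k),\qquad x\in\mathbb S^d.$$ Define operators $\mathcal M_j$ and $\mathcal E_j$ by $\mathcal M_0f=0$, $\mathcal E_0f=f$ and, for $j\ge1$, $\mathcal M_jf=\mathcal M_{j-1}f+Q_{X_j,\rho_j}\mathcal E_{j-1}f$ and $\mathcal E_jf=\mathcal E_{j-1}f-Q_{X_j,\rho_j}\mathcal E_{j-1}f$. Then for every $n\ge1$ $$\mathcal M_n=\sum_{j=1}^nQ_{X_j,\rho_j}\prod_{\ell=1}^{j-1}\big(I-Q_{X_\ell,\rho_\ell}\big),\qquad \mathcal E_n=\prod_{j=1}^n\big(I-Q_{X_j,\rho_j}\big),$$ where $I$ is the identity operator.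
   Context: $\mathbb S^d$ is the unit sphere of $\mathbb R^{d+1}$ and $\mu$ is a rotationally invariant measure on it. The operators act on (continuous) functions on $\mathbb S^d$. The scaled zonal kernel is $\varphi_\rho(x\cdot y)=\Lambda_{\phi,\rho}^{-1}\phi(\rho^{-1}\|x-y\|)$ for $x,y\in\mathbb S^d$, $0<\rho<1$, where $\phi\in C[0,\infty]$ and $\Lambda_{\phi,\rho}=\int_{\mathbb S^d}\phi(\rho^{-1}\|x-y\|)\,d\mu(x)$. The sets $X_1,X_2,\dots$ are quasi-uniform QMC sets: their fill distances satisfy $h_{j+1}\approx\delta h_j$ for a fixed $\delta\in(0,1)$, their separation distances $q_j$ satisfy $q_j\le h_j\le c_qq_j$ with a constant $c_q\ge1$, and $|X_j|=\mathcal O(h_j^{-d})$. Operator product convention: products are compositions ordered with the highest index applied last (leftmost), i.e. $\prod_{j=1}^n A_j=A_nA_{n-1}\cdots A_1$, and the empty product is $I$. *)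

(* Defs.v *)
From HB Require Import structures.
From mathcomp Require Import all_boot all_order all_algebra.
From mathcomp Require Import finmap.
From mathcomp Require Import all_classical all_reals all_analysis.

Set Implicit Arguments.
Unset Strict Implicit.
Unset Printing Implicit Defensive.

Import Order.TTheory GRing.Theory Num.Theory.
Import numFieldNormedType.Exports.

Local Open Scope classical_set_scope.
Local Open Scope ring_scope.

(* The norm that the library puts on row vectors is the sup norm, hence the
   Euclidean structure below. *)
Definition dotv (R : realType) (n : nat) (x y : 'rV[R]_n) : R :=
  \sum_(i < n) x 0 i * y 0 i.

Definition enorm (R : realType) (n : nat) (x : 'rV[R]_n) : R :=
  Num.sqrt (dotv x x).

Definition unit_vectors (R : realType) (d : nat) : set 'rV[R]_d.+1 :=
  [set x | enorm x = 1].
Arguments unit_vectors : clear implicits.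

(* S^d, a subset of R^(d+1), with the topology induced by R^(d+1). *)
Definition Sphere (R : realType) (d : nat) : Type :=
  set_type (unit_vectors R d).

HB.instance Definition _ (R : realType) (d : nat) :=
  Topological.copy (Sphere R d) (set_type (unit_vectors R d)).

Definition vec (R : realType) (d : nat) (x : Sphere R d) : 'rV[R]_d.+1 :=
  set_val x.

Lemma enorm_delta0 (R : realType) (d : nat) :
  (delta_mx 0 0 : 'rV[R]_d.+1) \in unit_vectors R d.
Proof.
rewrite inE /unit_vectors /= /enorm /dotv (bigD1 ord0) //= big1; last first.
  by move=> i i0; rewrite !mxE eqxx (negbTE i0) mul0r.
by rewrite !mxE !eqxx mulr1 addr0 sqrtr1.
Qed.

(* The library's measurable types are pointed. *)
HB.instance Definition _ (R : realType) (d : nat) :=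
  isPointed.Build (Sphere R d)
    (exist (fun x => x \in unit_vectors R d) _ (enorm_delta0 R d)).

Notation BorelSphere R d := (g_sigma_algebraType (@open (Sphere R d))).

(* Invariance under SO(d+1), acting by x |-> x A. *)
Definition rotation_invariant (R : realType) (d : nat)
    (mu : set (BorelSphere R d) -> \bar R) : Prop :=
  forall A : 'M[R]_d.+1, A *m A^T = 1%:M -> \det A = 1 ->
  forall B : set (BorelSphere R d), measurable B ->
    mu [set y | exists2 x, B x & vec y = vec x *m A] = mu B.

(* phi belongs to C[0, oo]: continuous on [0, oo[ with a finite limit at oo. *)
Definition continuous_0oo (R : realType) (phi : R -> R) : Prop :=
  {within `[0, +oo[, continuous phi} /\ cvg (phi t @[t --> +oo]).

Section kernel.
Variables (R : realType) (d : nat).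
Variable mu : {finite_measure set (BorelSphere R d) -> \bar R}.
Variable phi : R -> R.

(* When mu is rotation invariant (d >= 1) this does not depend on y. *)
Definition Lambda (rho : R) (y : Sphere R d) : R :=
  \int[mu]_x phi (rho^-1 * enorm (vec x - vec y)).

Definition scaled_kernel (rho : R) (x y : Sphere R d) : R :=
  (Lambda rho y)^-1 * phi (rho^-1 * enorm (vec x - vec y)).

Definition quasi_interpolant (X : {fset Sphere R d}) (rho : R)
    (f : Sphere R d -> R) : Sphere R d -> R :=
  fun x => (#|` X|%:R)^-1 * \sum_(y <- X) f y * scaled_kernel rho x y.

End kernel.

Section point_sets.
Variables (R : realType) (d : nat).

(* Geodesic distance on the sphere. *)
Definition sdist (x y : Sphere R d) : R := acos (dotv (vec x) (vec y)).

Definition fill_distance (X : {fset Sphere R d}) : R :=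
  sup [set inf [set sdist x y | y in [set` X]] | x in [set: Sphere R d]].

(* Meaningful when X has at least two points; it is 0 otherwise. *)
Definition separation_distance (X : {fset Sphere R d}) : R :=
  2^-1 * inf [set sdist p.1 p.2 | p in
                [set p | p.1 \in X /\ p.2 \in X /\ p.1 != p.2]].

(* Sequences are indexed from 1; X 0 is irrelevant. *)
Definition quasi_uniform_QMC (delta cq : R) (X : nat -> {fset Sphere R d}) :
    Prop :=
  [/\ forall j, (1 <= j)%N -> X j != fset0,
      exists2 c : R * R, 0 < c.1 /\ 0 < c.2 &
        forall j, (1 <= j)%N ->
          c.1 * (delta * fill_distance (X j)) <= fill_distance (X j.+1)
            <= c.2 * (delta * fill_distance (X j)),
      forall j, (1 <= j)%N ->
        separation_distance (X j) <= fill_distance (X j)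
          <= cq * separation_distance (X j) &
      exists C : R, forall j, (1 <= j)%N ->
        #|` X j|%:R <= C * fill_distance (X j) ^- d].

End point_sets.

Section multilevel.
Variables (V : zmodType) (Q : nat -> V -> V).

(* E_n *)
Fixpoint ml_residual (n : nat) (f : V) : V :=
  if n is m.+1 then ml_residual m f - Q m.+1 (ml_residual m f) else f.

(* M_n *)
Fixpoint ml_approx (n : nat) (f : V) : V :=
  if n is m.+1 then ml_approx m f + Q m.+1 (ml_residual m f) else 0.

End multilevel.

(* A_(n-1) \o ... \o A_m, the highest index being applied last. *)
Definition op_prod (V : Type) (A : nat -> V -> V) (m n : nat) : V -> V :=
  \big[(fun F G : V -> V => F \o G) / idfun]_(j <- rev (index_iota m n)) A j.

(* Main.v *)
Require Import Defs.
From mathcomp Require Import all_boot all_order all_algebra.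
From mathcomp Require Import finmap.
From mathcomp Require Import all_classical all_reals all_analysis.

Import Order.TTheory GRing.Theory Num.Theory.
Import numFieldNormedType.Exports.

Local Open Scope classical_set_scope.
Local Open Scope ring_scope.

(** Both formulas are unrollings of the recursion that defines the scheme.  The
    residual obeys [E_j = (I - Q_j) E_(j-1)], so it is the product of the factors
    [I - Q_j]; the approximation grows at level [j] by [Q_j E_(j-1)], so it is
    the telescoped sum of these corrections, in which [E_(j-1)] may be replaced
    by its product form.  Each term is a composition whose outermost operator
    comes last in the scheme, and no operator is ever moved past another or
    distributed over a sum, so the identities hold for arbitrary self-maps [Q_j]
    of an abelian group: [ml_residual_prod] and [ml_approx_sum].  The theorem is
    the case of the real functions on the sphere. *)

(** The product is folded over the reversed range, so that extending the range
    upwards adds a factor on the left, outside the existing composition. *)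
Lemma op_prod_recr (V : Type) (A : nat -> V -> V) (m n : nat) :
  (m <= n)%N -> op_prod A m n.+1 = A n \o op_prod A m n.
Proof.
move=> mn; rewrite /op_prod /index_iota subSn // -addn1 iotaD subnKC //.
by rewrite cats1 rev_rcons big_cons.
Qed.

Lemma ml_residual_prod (V : zmodType) (Q : nat -> V -> V) (n : nat) :
  ml_residual Q n = op_prod (fun j => (idfun : V -> V) - Q j) 1 n.+1.
Proof.
elim: n => [|n IHn]; first by rewrite /op_prod big_nil.
by rewrite op_prod_recr // -IHn.
Qed.

Lemma ml_approx_sum (V : zmodType) (Q : nat -> V -> V) (n : nat) :
  ml_approx Q n =
    \sum_(1 <= j < n.+1) (Q j \o op_prod (fun l => (idfun : V -> V) - Q l) 1 j).
Proof.
elim: n => [|n IHn]; first by rewrite big_nil.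
by rewrite big_nat_recr //= -IHn -ml_residual_prod.
Qed.

Theorem proposition3p6 (R : realType) (d : nat)
    (mu : {finite_measure set (BorelSphere R d) -> \bar R})
    (mu_rot : rotation_invariant mu)
    (phi : R -> R) (phi_cont : continuous_0oo phi)
    (rho : nat -> R)
    (rho01 : forall j : nat, (1 <= j)%N -> 0 < rho j < 1)
    (delta cq : R) (delta01 : 0 < delta < 1) (cq1 : 1 <= cq)
    (X : nat -> {fset Sphere R d}) (X_qu : quasi_uniform_QMC delta cq X)
    (n : nat) (n1 : (1 <= n)%N) :
  let Q (j : nat) : (Sphere R d -> R) -> Sphere R d -> R :=
    quasi_interpolant mu phi (X j) (rho j) in
  let I : (Sphere R d -> R) -> Sphere R d -> R := idfun in
  ml_approx Q n =
    \sum_(1 <= j < n.+1) (Q j \o op_prod (fun l => I - Q l) 1 j) /\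
  ml_residual Q n = op_prod (fun j => I - Q j) 1 n.+1.
Proof.
by move=> Q I; split; [exact: ml_approx_sum | exact: ml_residual_prod].
Qed.
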